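(* Let $A\in\mathbb{R}^{m\times n}$ with $m\ge n$, let $[a,b]\subset[\sigma_{\min},\|A\|]$ with $a<b$, and let $P_S$ be the (generalized) spectral projector of $S=A^TA$ associated with the singular values of $A$ in $[a,b]$ and $P=\psi_d(l(S))$ its Chebyshev--Jackson approximation of degree $d$. Let $\alpha=\arccos(l(a^2))$, $\beta=\arccos(l(b^2))$, and $$\Delta_{il}=|\arccos(l(\sigma_{il}^2))-\alpha|,\quad \Delta_{ir}=|\arccos(l(\sigma_{ir}^2))-\beta|,\quad \Delta_{ol}=|\arccos(l(\sigma_{ol}^2))-\alpha|,\quad \Delta_{or}=|\arccos(l(\sigma_{or}^2))-\beta|,$$ where $\sigma_{il},\sigma_{ir}$ and $\sigma_{ol},\sigma_{or}$ are the singular values of $A$ closest to the ends $a$ and $b$ from inside and from outside of $[a,b]$, respectively (all four assumed to exist): $\sigma_{il}$ and $\sigma_{ir}$ are the smallest and largest singular values in $(a,b)$, $\sigma_{ol}$ is the largest singular value less than $a$, and $\sigma_{or}$ is the smallest singular value greater than $b$. Define $\Delta_{\min}=\min\{\Delta_{il},\Delta_{ir},\Delta_{ol},\Delta_{or}\}$. Then $$\|P_S-P\|\le\frac{\pi^6}{2(d+2)^3\Delta_{\min}^4}.$$ Suppose moreover that the singular values of $A$ (with multiplicity) in $[a,b]$ are $\sigma_1,\ldots,\sigma_{n_{sv}}$, with $\sigma_1,\ldots,\sigma_r$ in $(a,b)$ and $\sigma_{r+1},\ldots,\sigma_{n_{sv}}$ equal to $a$ or $b$, and that those in $[\sigma_{\min},\|A\|]\setminus[a,b]$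 are $\sigma_{n_{sv}+1},\ldots,\sigma_n$; and label the eigenvalues $\gamma_i=\psi_d(l(\sigma_i^2))$ of $P$ for $i=1,\ldots,r$, for $i=r+1,\ldots,n_{sv}$, and for $i=n_{sv}+1,\ldots,n$ in decreasing order within each of these three groups. If $$d\ge\frac{\sqrt[3]{2}\,\pi^2}{\Delta_{\min}^{4/3}}-2,$$ then $$\|P_S-P\|<\frac14$$ and $$1\ge\gamma_1\ge\cdots\ge\gamma_r>\frac34>\gamma_{r+1}\ge\cdots\ge\gamma_{n_{sv}}>\frac14>\gamma_{n_{sv}+1}\ge\cdots\ge\gamma_n\ge 0$$ (if the middle group is empty, i.e. $r=n_{sv}$, its entries are omitted from the chain).
   Context: $\|\cdot\|$ is the 2-norm (spectral norm for matrices), $\sigma_{\min}=\sigma_{\min}(A)$ is the smallest of the $n$ singular values of $A$. Let $V=[v_1,\dots,v_n]$ be an orthogonal matrix of right singular vectors of $A$, so $V^TSV=\Sigma^2$ with $\Sigma$ the diagonal matrix of the $n$ singular values. The spectral projector is $P_S=V_{in}V_{in}^T+\frac12V_{ab}V_{ab}^T$, where $V_{in}$ consists of the columns of $V$ belonging to eigenvalues of $S$ in the open interval $(a^2,b^2)$ and $V_{ab}$ of the columns belonging to eigenvalues of $S$ equal to $a^2$ or $b^2$. The linear map $l(x)=\frac{2x-\|A\|^2-\sigma_{\min}^2}{\|A\|^2-\sigma_{\min}^2}$ maps $[\sigma_{\min}^2,\|A\|^2]$ onto $[-1,1]$. The Chebyshev--Jackson series of degree $d$ (a positive integer) of the step function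 associated with $[l(a^2),l(b^2)]$ is $\psi_d(x)=\frac{c_0}{2}+\sum_{j=1}^d\rho_{j,d}c_jT_j(x)$, where $T_j$ is the Chebyshev polynomial of the first kind of degree $j$, $c_0=\frac2\pi(\alpha-\beta)$, $c_j=\frac{2}{\pi}\frac{\sin(j\alpha)-\sin(j\beta)}{j}$ for $j\ge1$, with $\alpha=\arccos(l(a^2))$, $\beta=\arccos(l(b^2))$, and $$\rho_{j,d}=\frac{(d+2-j)\sin(\frac{\pi}{d+2})\cos(\frac{j\pi}{d+2})+\cos(\frac{\pi}{d+2})\sin(\frac{j\pi}{d+2})}{(d+2)\sin\frac{\pi}{d+2}}.$$ The approximate projector is $P=\psi_d(l(S))$ (matrix polynomial in $S$), which has eigenvectors $v_i$ and eigenvalues $\gamma_i=\psi_d(l(\sigma_i^2))$. *)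

(* Defs.v *)
From HB Require Import structures.
From mathcomp Require Import all_boot all_order all_algebra.
From mathcomp Require Import all_classical all_reals all_analysis.

Set Implicit Arguments.
Unset Strict Implicit.
Unset Printing Implicit Defensive.

Import Order.TTheory GRing.Theory Num.Theory.
Local Open Scope classical_set_scope.
Local Open Scope ring_scope.

Definition norm2 {R : realType} {n : nat} (x : 'cV[R]_n) : R :=
  Num.sqrt (\sum_i x i 0 ^+ 2).

(* The norm `|M| that MathComp-Analysis puts on matrices is the largest
   absolute value of an entry, so the spectral norm is defined here, as the
   operator norm induced by [norm2]. *)
Definition spectral_norm {R : realType} {m n : nat} (M : 'M[R]_(m, n)) : R :=
  sup [set norm2 (M *m x) | x in [set x : 'cV[R]_n | norm2 x <= 1]].

(* Singular value decomposition A = U Sigma V^T in thin form: U has n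
   orthonormal columns, which is the right shape for n <= m. The entries of s
   are the n singular values with multiplicity, in arbitrary order, and the
   columns of the orthogonal matrix V are right singular vectors. *)
Definition is_svd {R : realType} {m n : nat} (A U : 'M[R]_(m, n))
    (s : 'rV[R]_n) (V : 'M[R]_n) : Prop :=
  [/\ U^T *m U = 1%:M, V^T *m V = 1%:M, (forall i, 0 <= s 0 i)
    & A = U *m diag_mx s *m V^T].

Definition is_smallest {R : realType} (E : set R) (x : R) : Prop :=
  E x /\ lbound E x.

Definition is_largest {R : realType} (E : set R) (x : R) : Prop :=
  E x /\ ubound E x.

Definition subcols {R : realType} {n : nat} (V : 'M[R]_n) (J : {set 'I_n}) :
  'M[R]_(n, #|J|) := colsub (fun j : 'I_#|J| => enum_val j) V.

(* Column i of V belongs to the eigenvalue (s 0 i) ^+ 2 of A^T A. *)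
Definition spectral_projector {R : realType} {n : nat} (s : 'rV[R]_n)
    (V : 'M[R]_n) (a b : R) : 'M[R]_n :=
  let Vin := subcols V [set i | a ^+ 2 < s 0 i ^+ 2 < b ^+ 2]%SET in
  let Vab := subcols V
    [set i | (s 0 i ^+ 2 == a ^+ 2) || (s 0 i ^+ 2 == b ^+ 2)]%SET in
  Vin *m Vin^T + 2^-1 *: (Vab *m Vab^T).

(* The map l, for N = ||A|| and smin the smallest singular value, as a
   polynomial so that it applies to numbers and to matrices. *)
Definition lmap {R : realType} (N smin : R) : {poly R} :=
  (N ^+ 2 - smin ^+ 2)^-1 *: (2 *: 'X - (N ^+ 2 + smin ^+ 2)%:P).

Fixpoint chebyshevT (R : realType) (j : nat) : {poly R} :=
  match j with
  | 0 => 1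
  | 1 => 'X
  | (j''.+1 as j').+1 => 2 *: 'X * chebyshevT R j' - chebyshevT R j''
  end.

Definition step_coef {R : realType} (alpha beta : R) (j : nat) : R :=
  if j == 0%N then 2 / pi * (alpha - beta)
  else 2 / pi * ((sin (j%:R * alpha) - sin (j%:R * beta)) / j%:R).

Definition jackson {R : realType} (d j : nat) : R :=
  let t : R := pi / (d%:R + 2) in
  ((d%:R + 2 - j%:R) * sin t * cos (j%:R * t) + cos t * sin (j%:R * t))
  / ((d%:R + 2) * sin t).

Definition cheb_jackson {R : realType} (alpha beta : R) (d : nat) : {poly R} :=
  (step_coef alpha beta 0%N / 2)%:P
  + \sum_(1 <= j < d.+1) (jackson d j * step_coef alpha beta j) *: chebyshevT R j.

(* Main.v *)
Require Import Defs.
From HB Require Import structures.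
From mathcomp Require Import all_boot all_order all_algebra all_fingroup.
From mathcomp Require Import all_classical all_reals all_analysis.
From mathcomp Require Import ring lra.

Set Implicit Arguments.
Unset Strict Implicit.
Unset Printing Implicit Defensive.

Import Order.TTheory GRing.Theory Num.Theory numFieldNormedType.Exports.
Local Open Scope classical_set_scope.
Local Open Scope ring_scope.

(** Put x = cos t. The step function then becomes the even 2 pi-periodic function
    h equal to 1 between beta and alpha, to 0 beyond them in [0, pi], and to 1/2 at
    the two jumps. The Chebyshev--Jackson sum at cos t is the convolution of h with
    the Jackson kernel u(t) = 1 + 2 sum_j rho_j cos (j t), normalised to mean 1.

    The kernel is nonnegative, because its coefficients rho_j are, up to a constant,
    the autocorrelation of the sequence sin ((k + 1) tau), tau = pi / (d + 2), so that
    u is proportional to the squared modulus of a trigonometric sum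
    ([jackson_kernel_ge0]). Hence all values of the approximation lie in [0, 1], and at
    a point whose distance to the jumps is at least delta the error is at most the mass
    of u outside [-delta, delta]. At a jump, the evenness of u makes the part of the
    convolution near the jump contribute exactly one half, so the approximation is
    close to 1/2 there ([cheb_jackson_error]).

    The mass in the tail is estimated by Chebyshev's inequality for the weight
    (1 - cos t)^2 = 3/2 - 2 cos t + cos (2 t) / 2. Its mean against u only involves
    rho_1 and rho_2, and equals (1 - cos tau)^2 + (sin tau)^2 / (d + 2), which is of
    order (d + 2)^-3. This third power is the gain of the Jackson damping. With
    1 - cos delta >= 2 delta^2 / pi^2 and pi^2 < 12 the tail is strictly smaller than
    pi^6 / (2 (d + 2)^3 delta^4) ([jackson_tail_lt]); the strictness is what turns the
    condition on d into the strict bound by 1/4.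

    Every integral above is the increment of an explicit primitive: F is the odd
    primitive of u, it is nondecreasing, F (t + 2 pi) = F t + 2 pi, and 2 pi times the
    approximation at t is F (t - beta) - F (t - alpha) + F (t + alpha) - F (t + beta)
    ([cheb_jackson_cosE]). All the bounds follow from these properties of F and from
    the lower bound for F at delta.

    For the matrices, the right singular vectors diagonalise both the projector and its
    approximation, so the spectral norm of the difference is at most the largest error
    at the angles of the singular values. The angle is a strictly decreasing function
    of the singular value, which gives the distances delta = Delta_min between these
    angles and the jumps. It also gives that alpha - beta, beta and pi - alpha are at
    least delta: each of these intervals contains the angle of one of the four singular
    values next to a or b. *)

(** * Elementary inequalities for sine and cosine *)

(** This form takes the derivative as a given function, so that monotonicity
    arguments below only have to exhibit a pair (function, derivative). *)
Lemma is_derive_ge0_le {R : realType} (f df : R -> R) (a b : R) :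
  (forall x : R, is_derive x 1 f (df x)) ->
  (forall x, a < x < b -> 0 <= df x) -> a <= b -> f a <= f b.
Proof.
move=> fdf df0 ab.
have drv x : derivable f x 1 by case: (fdf x).
apply: (@ger0_derive1_le_cc R f a b) => //.
- move=> x; rewrite in_itv/= => xab.
  by rewrite derive1E (@derive_val _ _ _ _ _ _ _ (fdf x)) df0.
- by apply: derivable_within_continuous => x _.
- by rewrite in_itv/= lexx.
- by rewrite in_itv/= lexx ab.
Qed.

Lemma sin_le_id {R : realType} (x : R) : 0 <= x -> sin x <= x.
Proof.
move=> x0; have := @is_derive_ge0_le R (fun t => t - sin t) (fun t => 1 - cos t) 0 x.
rewrite sin0 !subr0 subr_ge0; apply=> // t _; by rewrite subr_ge0 cos_le1.
Qed.

Lemma cos_ge_taylor2 {R : realType} (x : R) : 0 <= x -> 1 - x ^+ 2 / 2 <= cos x.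
Proof.
move=> x0; have := @is_derive_ge0_le R (fun t => cos t + t ^+ 2 / 2)
  (fun t => t - sin t) 0 x.
rewrite cos0 expr0n/= mul0r addr0 -lerBlDr; apply=> // t.
  by apply: is_derive_eq; rewrite /GRing.scale/=; lra.
by move=> /andP[t0 _]; rewrite subr_ge0 sin_le_id// ltW.
Qed.

Lemma sin_ge_taylor3 {R : realType} (x : R) : 0 <= x -> x - x ^+ 3 / 6 <= sin x.
Proof.
move=> x0; have := @is_derive_ge0_le R (fun t => sin t - t + t ^+ 3 / 6)
  (fun t => cos t - 1 + t ^+ 2 / 2) 0 x.
rewrite sin0 expr0n/= mul0r !addr0 subr0 => H; suff: 0 <= sin x - x + x ^+ 3 / 6 by lra.
apply: H => // t.
  by apply: is_derive_eq; rewrite /GRing.scale/=; lra.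
by move=> /andP[t0 _]; have := cos_ge_taylor2 (ltW t0); lra.
Qed.

Lemma cos_le_taylor4 {R : realType} (x : R) :
  0 <= x -> cos x <= 1 - x ^+ 2 / 2 + x ^+ 4 / 24.
Proof.
move=> x0; have := @is_derive_ge0_le R (fun t => - cos t - t ^+ 2 / 2 + t ^+ 4 / 24)
  (fun t => sin t - t + t ^+ 3 / 6) 0 x.
rewrite cos0 !expr0n/= !mul0r !addr0 subr0 => H.
suff: -1 <= - cos x - x ^+ 2 / 2 + x ^+ 4 / 24 by lra.
apply: H => // t.
  by apply: is_derive_eq; rewrite /GRing.scale/=; lra.
by move=> /andP[t0 _]; have := sin_ge_taylor3 (ltW t0); lra.
Qed.

(** At the square root of 3 the Taylor polynomial of degree 4 of the cosine is
    1 - 3/2 + 9/24 < 0, so pi / 2 lies strictly before that point. *)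
Lemma sqr_pi_lt12 {R : realType} : (pi : R) ^+ 2 < 12.
Proof.
rewrite ltNge; apply/negP => h.
have s0 : 0 <= Num.sqrt 3 :> R by rewrite sqrtr_ge0.
have s2 : Num.sqrt 3 ^+ 2 = 3 :> R by rewrite sqr_sqrtr.
have ps : Num.sqrt 3 <= pi / 2 :> R.
  rewrite -(@ler_pXn2r _ 2)// ?nnegrE ?divr_ge0 ?pi_ge0//.
  by rewrite s2 expr_div_n; lra.
have : 0 <= cos (Num.sqrt 3 : R).
  by apply: cos_ge0_pihalf; have := pi_ge0 R; lra.
have s4 : Num.sqrt 3 ^+ 4 = 9 :> R by rewrite (exprM _ 2 2) s2; lra.
by have := cos_le_taylor4 s0; rewrite s2 s4; lra.
Qed.

(** Jordan's inequality. The derivative of pi sin - 2 id decreases, so this function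
    increases and then decreases on [0, pi/2], and it vanishes at both ends. Which end
    to compare with is decided by the sign of the derivative at x. *)
Lemma pi_sin_ge {R : realType} (x : R) : 0 <= x <= pi / 2 -> 2 * x <= pi * sin x.
Proof.
move=> /andP[x0 xp]; have p0 := pi_gt0 R.
have mono y z : 0 <= y -> y <= z -> z <= pi / 2 -> cos z <= cos y :> R.
  move=> y0 yz zp; rewrite leNgt ltr_cos ?in_itv/= -?leNgt//; lra.
have drv k (t : R) : is_derive t 1 (fun t => k * (pi * sin t - 2 * t)) (k * (pi * cos t - 2)).
  by apply: is_derive_eq; rewrite /GRing.scale/=; lra.
(* The factor k = 1 or -1 serves both the increasing and the decreasing case. *)
have [h|h] := leP 2 (pi * cos x).
  have := @is_derive_ge0_le R _ _ 0 x (drv 1); rewrite sin0 !mulr0 subrr mulr0 !mul1r.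
  rewrite subr_ge0; apply => // t /andP[t0 tx]; rewrite mul1r subr_ge0 (le_trans h)//.
  by rewrite ler_pM2l// mono// ltW.
have := @is_derive_ge0_le R _ _ x (pi / 2) (drv (-1)).
rewrite sin_pihalf => H; suff : 0 <= pi * sin x - 2 * x by lra.
have {}H : - 1 * (pi * sin x - 2 * x) <= - 1 * (pi * 1 - 2 * (pi / 2)); last by lra.
apply: H => // t /andP[tx tp].
have : pi * cos t <= pi * cos x by rewrite ler_pM2l// mono// ltW.
by lra.
Qed.

Lemma cos_half {R : realType} (x : R) : 1 - cos x = 2 * sin (x / 2) ^+ 2.
Proof. by rewrite {1}[x](_ : _ = (x / 2) *+ 2); [rewrite cos_mulr2n cos2sin2; lra | lra]. Qed.

Lemma one_sub_cos_ge {R : realType} (x : R) :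
  0 <= x <= pi -> 2 * x ^+ 2 <= pi ^+ 2 * (1 - cos x).
Proof.
rewrite cos_half (_ : pi ^+ 2 * _ = 2 * (pi * sin (x / 2)) ^+ 2); last by ring.
move=> /andP[x0 xp]; rewrite ler_pM2l//.
rewrite ler_pXn2r ?nnegrE//.
- by have := @pi_sin_ge R (x / 2); lra.
- by rewrite mulr_ge0 ?pi_ge0// sin_ge0_pi//; lra.
Qed.

Lemma one_sub_cos_le {R : realType} (x : R) : 0 <= x -> 1 - cos x <= x ^+ 2 / 2.
Proof. by move=> /cos_ge_taylor2; lra. Qed.

(** * The Jackson kernel *)

(** An even trigonometric sum with Fourier coefficients c_j has cosine coefficients
    c_0 and 2 c_j. *)
Definition cos_weight {R : realType} (j : nat) : R := if j == 0%N then 1 else 2.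

(** The left side is the squared modulus of sum_k f_k e^(ikt). The induction on the
    number of terms avoids regrouping the double sum along its diagonals: each new term
    adds one product to every inner sum. *)
Lemma sqr_norm_trig_sum {R : realType} (N : nat) (f : nat -> R) (t : R) :
  (\sum_(k < N) f k * cos (k%:R * t)) ^+ 2
    + (\sum_(k < N) f k * sin (k%:R * t)) ^+ 2
  = \sum_(j < N) cos_weight j * cos (j%:R * t)
      * \sum_(k < N - j) f k * f (k + j)%N.
Proof.
elim: N => [|N IH]; first by rewrite !big_ord0 expr0n/= addr0.
have split_inner (j : nat) : (j <= N)%N ->
    \sum_(k < N.+1 - j) f k * f (k + j)%N
    = \sum_(k < N - j) f k * f (k + j)%N + f (N - j)%N * f N.
  by move=> jN; rewrite subSn// big_ord_recr/= subnK.
under [RHS]eq_bigr => j _ do rewrite split_inner ?leq_ord// mulrDr.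
rewrite big_split/= [X in _ = X + _]big_ord_recr/= subnn big_ord0 mulr0 addr0.
rewrite -IH 2!big_ord_recr/= [X in _ = _ + X]big_ord_recl/=.
(* The new diagonal terms j >= 1 pair the new coefficient f N with all earlier ones. *)
set C := \sum_(k < N) _; set S := \sum_(k < N) _.
suff -> : \sum_(i < N) cos_weight (bump 0 i) * cos ((bump 0 i)%:R * t)
       * (f (N - bump 0 i)%N * f N)
    = 2 * f N * (cos (N%:R * t) * C + sin (N%:R * t) * S).
  rewrite subn0 /cos_weight eqxx mul0r cos0.
  have := cos2Dsin2 (N%:R * t); move: (cos (N%:R * t)) (sin (N%:R * t)) => x y h.
  have -> : (C + f N * x) ^+ 2 + (S + f N * y) ^+ 2
     = C ^+ 2 + S ^+ 2 + f N ^+ 2 * (x ^+ 2 + y ^+ 2) + 2 * f N * (x * C + y * S) by ring.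
  by rewrite h; ring.
(* j = N - k: the difference formula for cos ((N - k) t). *)
rewrite mulrDr !mulr_sumr -big_split/= (reindex_inj rev_ord_inj)/=.
apply: eq_bigr => k _; rewrite /bump/= add1n subnSK// subKn ?(ltnW (ltn_ord k))//.
rewrite /cos_weight ifF; last by rewrite subn_eq0 leqNgt ltn_ord.
by rewrite natrB ?(ltnW (ltn_ord k))// mulrBl cosB; ring.
Qed.

(** After multiplication by 2 sin t, the part of the product that depends on k
    telescopes. *)
Lemma sin_autocorrelation {R : realType} (m : nat) (t y : R) :
  2 * sin t * \sum_(k < m) sin (k.+1%:R * t) * sin (k.+1%:R * t + y)
  = sin t * m%:R * cos y - (sin ((2 * m%:R + 1) * t + y) - sin (t + y)) / 2.
Proof.
elim: m => [|m IH]; first by rewrite big_ord0 (_ : (2 * 0%:R + 1) * t = t); ring.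
rewrite big_ord_recr/= mulrDr IH.
set x := m.+1%:R * t; set z := x + y.
have -> : cos y = cos (z - x) by congr cos; rewrite /z; ring.
have -> : (2 * m%:R + 1) * t + y = z + x - t by rewrite /z /x -natr1; ring.
have -> : (2 * m.+1%:R + 1) * t + y = z + x + t by rewrite /z /x; ring.
by rewrite !(cosD, sinD, cosN, sinN) -[m.+1%:R]natr1; field.
Qed.

Section Jackson.
Variables (R : realType) (d : nat).
Let tau : R := pi / (d%:R + 2).

Let D0 : 0 < d%:R + 2 :> R. Proof. by have := ler0n R d; lra. Qed.
Let tauE : (d%:R + 2) * tau = pi.
Proof. by rewrite /tau mulrC divfK ?gt_eqF. Qed.
Let tau0 : 0 < tau. Proof. by rewrite divr_gt0 ?pi_gt0. Qed.

Lemma sin_pi_div_gt0 : 0 < sin (pi / (d%:R + 2)) :> R.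
Proof.
apply: sin_gt0_pi; rewrite -/tau tau0/= -tauE ltr_pMl//.
by have := ler0n R d; lra.
Qed.

Let sn0 : sin tau != 0. Proof. by rewrite gt_eqF// sin_pi_div_gt0. Qed.

Lemma jackson0 : jackson d 0 = 1 :> R.
Proof.
by rewrite /jackson -/tau subr0 mul0r cos0 sin0 mulr1 mulr0 addr0 divff// mulf_neq0// gt_eqF.
Qed.

Lemma jackson1 : jackson d 1 = cos tau.
Proof. by rewrite /jackson -/tau mul1r; field; rewrite sn0 gt_eqF. Qed.

Lemma jackson2 : jackson d 2 = cos tau ^+ 2 - sin tau ^+ 2 + 2 * sin tau ^+ 2 / (d%:R + 2).
Proof.
rewrite /jackson -/tau -[2 * tau]/(2 * tau) (_ : 2 * tau = tau + tau); last by ring.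
by rewrite cosD sinD; field; rewrite sn0 gt_eqF.
Qed.

(** The coefficient just beyond the degree vanishes. The sums below therefore run up to
    d + 1, which makes jackson d 2 occur among the indices even for d = 1. *)
Lemma jackson_last : jackson d d.+1 = 0 :> R.
Proof.
rewrite /jackson -/tau (_ : d%:R + 2 - d.+1%:R = 1); last by rewrite -natr1; ring.
rewrite mul1r -sinD (_ : tau + _ = pi) ?sinpi ?mul0r//.
by rewrite -tauE -natr1; ring.
Qed.

(** The number d + 2 - j of terms is such that the telescoped sine is taken at an
    angle differing from tau - j tau by a full turn. *)
Lemma jackson_autocorrelation (j : nat) : (j < d.+2)%N ->
  \sum_(k < d.+2 - j) sin (k.+1%:R * tau) * sin ((k + j).+1%:R * tau)
  = (d%:R + 2) / 2 * jackson d j.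
Proof.
move=> jd; have := @sin_autocorrelation R (d.+2 - j) tau (j%:R * tau).
under eq_bigr => k _ do rewrite -mulrDl -natrD addSn.
rewrite natrB ?(ltnW jd)// (_ : d.+2%:R = d%:R + 2); last by rewrite -addn2 natrD.
have -> : (2 * (d%:R + 2 - j%:R) + 1) * tau + j%:R * tau
    = tau - j%:R * tau + pi *+ 2 by rewrite -tauE -mulr_natl; ring.
rewrite sinD2pi sinB sinD /jackson -/tau => h.
apply: (@mulfI _ (2 * sin tau)); first by rewrite mulf_neq0.
by rewrite h; field; rewrite sn0 gt_eqF.
Qed.

Definition jackson_kernel (t : R) : R :=
  \sum_(j < d.+2) cos_weight j * jackson d j * cos (j%:R * t).

Lemma jackson_kernel_ge0 t : 0 <= jackson_kernel t.
Proof.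
have := sqr_norm_trig_sum d.+2 (fun k => sin (k.+1%:R * tau)) t.
under [in RHS]eq_bigr => j _ do rewrite jackson_autocorrelation// mulrCA.
rewrite -mulr_sumr => h.
rewrite -(@pmulr_rge0 _ ((d%:R + 2) / 2)) ?divr_gt0// /jackson_kernel.
under eq_bigr => j _ do rewrite mulrAC.
by rewrite -h addr_ge0// sqr_ge0.
Qed.

End Jackson.

(** * Antiderivatives of the kernel *)

(** The primitive of cos (w t) vanishing at 0; the frequency is real so that shifted
    frequencies, possibly negative or zero, need no case analysis. *)
Definition cos_primitive {R : realType} (w t : R) : R :=
  if w == 0 then t else sin (w * t) / w.

Lemma is_derive_cos_primitive {R : realType} (w t : R) :
  is_derive t 1 (cos_primitive w) (cos (w * t)).
Proof.
rewrite /cos_primitive; case: eqVneq => [->|w0].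
  by rewrite mul0r cos0; exact: is_derive_id.
have -> : (fun t0 : R => sin (w * t0) / w) = w^-1 *: (sin \o (fun t0 : R => w * t0)).
  by apply/funext => x /=; rewrite /GRing.scale/= mulrC.
have h : is_derive t 1 (fun t0 : R => w * t0) w.
  by apply: is_derive_eq; rewrite /GRing.scale/= !(mulr0, mulr1, addr0, add0r).
apply: is_derive_eq; rewrite /GRing.scale/=.
by field.
Qed.

Lemma cos_primitiveN {R : realType} (w t : R) :
  cos_primitive w (- t) = - cos_primitive w t.
Proof. by rewrite /cos_primitive; case: ifP => // _; rewrite mulrN sinN mulNr. Qed.

Lemma sin_nat_pi {R : realType} (n : nat) : sin (n%:R * pi) = 0 :> R.
Proof.
elim: n => [|n IH]; first by rewrite mul0r sin0.
by rewrite -natr1 mulrDl mul1r sinDpi IH oppr0.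
Qed.

Lemma cos_primitive_pi {R : realType} (w : R) (n : nat) :
  w = n%:R \/ w = - n%:R -> w != 0 -> cos_primitive w pi = 0.
Proof.
rewrite /cos_primitive => h /negbTE ->.
by case: h => ->; rewrite ?mulNr ?sinN sin_nat_pi ?oppr0 mul0r.
Qed.

Lemma cos_primitive_0 {R : realType} (t : R) : cos_primitive 0 t = t.
Proof. by rewrite /cos_primitive eqxx. Qed.

Lemma cos_primitiveD2pi {R : realType} (j : nat) (t : R) :
  cos_primitive j%:R (t + pi *+ 2)
  = cos_primitive j%:R t + (if j == 0%N then pi *+ 2 else 0).
Proof.
rewrite /cos_primitive pnatr_eq0; case: ifP => // _.
rewrite addr0; congr (_ / _); rewrite mulrDr.
have e : j%:R * (pi *+ 2) = pi *+ 2 *+ j :> R by exact: mulr_natl.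
rewrite e.
exact: (periodicn (@sinD2pi R)).
Qed.

Lemma is_derive_sum_fun {R : realType} (n : nat) (h dh : 'I_n -> R -> R) (t : R) :
  (forall j, is_derive t 1 (h j) (dh j t)) ->
  is_derive t 1 (fun x => \sum_(j < n) h j x) (\sum_(j < n) dh j t).
Proof.
move=> H; have -> : (fun x => \sum_(j < n) h j x) = \sum_(j < n) h j.
  by apply/funext => x; rewrite fct_sumE.
exact: is_derive_sum.
Qed.

Section JacksonPrimitive.
Variables (R : realType) (d : nat).
Hypothesis d0 : (0 < d)%N.

Definition jackson_primitive (t : R) : R :=
  \sum_(j < d.+2) cos_weight j * jackson d j * cos_primitive j%:R t.

Lemma is_derive_jackson_primitive (t : R) :
  is_derive t 1 jackson_primitive (jackson_kernel d t).
Proof.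
apply: (@is_derive_sum_fun R d.+2 _
  (fun j t => cos_weight j * jackson d j * cos (j%:R * t))) => j.
have := is_derive_cos_primitive (j%:R : R) t => h.
by apply: is_derive_eq; rewrite /GRing.scale/= ?(mulr0, mul0r, addr0, add0r).
Qed.

Lemma jackson_primitive_mono (x y : R) :
  x <= y -> jackson_primitive x <= jackson_primitive y.
Proof.
apply: (is_derive_ge0_le is_derive_jackson_primitive) => t _.
exact: jackson_kernel_ge0.
Qed.

Lemma jackson_primitiveN (t : R) : jackson_primitive (- t) = - jackson_primitive t.
Proof. by rewrite -sumrN; apply: eq_bigr => j _; rewrite cos_primitiveN mulrN. Qed.

(** Only the constant term of the kernel has a non-periodic primitive, and its
    coefficient is 1. *)
Lemma jackson_primitiveD2pi (t : R) :
  jackson_primitive (t + pi *+ 2) = jackson_primitive t + pi *+ 2.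
Proof.
rewrite /jackson_primitive.
under eq_bigr => j _ do rewrite cos_primitiveD2pi mulrDr.
rewrite big_split/=; congr (_ + _).
rewrite big_ord_recl/= big1 ?addr0; first by rewrite jackson0 /cos_weight/= !mul1r.
by move=> j _; rewrite mulr0.
Qed.

Lemma jackson_primitive_pi : jackson_primitive pi = pi.
Proof.
have := jackson_primitiveD2pi (- pi); rewrite jackson_primitiveN.
by rewrite (_ : - pi + pi *+ 2 = pi); [rewrite mulr2n; lra | rewrite mulr2n; ring].
Qed.

(** A primitive of (1 - cos t)^2 cos (w t), read off the expansion
    (1 - cos t)^2 = 3/2 - 2 cos t + cos (2 t) / 2. *)
Let sqr_primitive (w t : R) : R := 3 / 2 * cos_primitive w t
  - cos_primitive (w + 1) t - cos_primitive (w - 1) t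
  + 4^-1 * (cos_primitive (w + 2) t + cos_primitive (w - 2) t).

Let is_derive_sqr_primitive (w t : R) :
  is_derive t 1 (sqr_primitive w) ((1 - cos t) ^+ 2 * cos (w * t)).
Proof.
have h := is_derive_cos_primitive.
have h0 := h R w t; have h1 := h R (w + 1) t; have h2 := h R (w - 1) t.
have h3 := h R (w + 2) t; have h4 := h R (w - 2) t.
apply: is_derive_eq; rewrite /GRing.scale/= ?(mulr0, mul0r, addr0, add0r).
have -> : (w + 2) * t = w * t + t + t by ring.
have -> : (w - 2) * t = w * t - t - t by ring.
have -> : (w + 1) * t = w * t + t by ring.
have -> : (w - 1) * t = w * t - t by ring.
rewrite !(cosD, sinD, cosN, sinN).
by have h5 := sin2cos2 t; field: h5.
Qed.

Let moment_coef (j : nat) : R :=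
  match j with 0 => 3 / 2 | 1 => - 1 | 2 => 4^-1 | _ => 0 end.

Let sqr_primitive_pi (j : nat) : sqr_primitive j%:R pi = pi * moment_coef j.
Proof.
rewrite /moment_coef.
have n0 k : k.+1%:R != 0 :> R by rewrite pnatr_eq0.
have z k : cos_primitive (k.+1%:R : R) pi = 0.
  by apply: (@cos_primitive_pi _ _ k.+1) => //; left.
have z' k : cos_primitive (- k.+1%:R : R) pi = 0.
  by apply: (@cos_primitive_pi _ _ k.+1); [right|rewrite oppr_eq0].
have z0 := @cos_primitive_0 R pi.
rewrite /sqr_primitive; case: j => [|[|[|j]]].
- by rewrite !add0r z0 (z 0%N) (z' 0%N) (z 1%N) (z' 1%N); field.
- rewrite subrr -[1 + 1](natrD _ 1 1) -[1 + 2](natrD _ 1 2) z0.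
  by rewrite (z 0%N) (z 1%N) (z 2%N) (_ : 1 - 2 = - 1) ?(z' 0%N); [field|ring].
- rewrite subrr -[2 + 1](natrD _ 2 1) -[2 + 2](natrD _ 2 2) z0.
  by rewrite (z 1%N) (z 2%N) (z 3%N) (_ : 2 - 1 = 1) ?(z 0%N); [field|ring].
- have -> : j.+3%:R + 1 = j.+4%:R :> R by rewrite natr1.
  have -> : j.+3%:R - 1 = j.+2%:R :> R by rewrite -natr1 addrK.
  have -> : j.+3%:R + 2 = j.+4.+1%:R :> R by rewrite -natrD addn2.
  have -> : j.+3%:R - 2 = j.+1%:R :> R by rewrite -addn2 natrD addrK.
  by rewrite !z; ring.
Qed.

Let moment_primitive (t : R) : R :=
  \sum_(j < d.+2) cos_weight j * jackson d j * sqr_primitive j%:R t.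

Let is_derive_moment_primitive (t : R) :
  is_derive t 1 moment_primitive ((1 - cos t) ^+ 2 * jackson_kernel d t).
Proof.
rewrite mulr_sumr.
apply: (@is_derive_sum_fun R d.+2 _
  (fun j t => (1 - cos t) ^+ 2 * (cos_weight j * jackson d j * cos (j%:R * t)))) => j.
have := is_derive_sqr_primitive (j%:R : R) t => h.
by apply: is_derive_eq; rewrite /GRing.scale/= ?(mulr0, mul0r, addr0, add0r); ring.
Qed.

(** The mean of (1 - cos t)^2 against the kernel, that is 3/2 - 2 rho_1 + rho_2 / 2. *)
Definition jackson_moment : R :=
  (1 - cos (pi / (d%:R + 2))) ^+ 2 + sin (pi / (d%:R + 2)) ^+ 2 / (d%:R + 2).

Let moment_primitive_pi : moment_primitive pi = pi * jackson_moment.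
Proof.
rewrite /moment_primitive; under eq_bigr => j _ do rewrite sqr_primitive_pi.
(* At pi the primitives of all nonzero integer frequencies vanish, so only j <= 2
   contributes; the range contains these three indices because d > 0. *)
rewrite -(big_mkord xpredT (fun j => cos_weight j * jackson d j * (pi * moment_coef j))).
rewrite big_ltn// big_ltn// big_ltn ?ltnS//.
rewrite big_nat big1 => [|[|[|[|j]]]//]; last by rewrite !mulr0.
rewrite /cos_weight/= jackson0 jackson1 jackson2 /jackson_moment.
have e0 : (d%:R + 2 : R) != 0 by rewrite -natrD pnatr_eq0 addn2.
by set t := pi / _; have h := sin2cos2 t; field: h.
Qed.

(** Chebyshev's inequality for the tail of the kernel: on [t, pi] the weight
    (1 - cos)^2 is at least (1 - cos t)^2. The integral over [t, pi] of the weight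
    against the kernel is at most the one over [0, pi], which is pi times the mean. *)
Lemma jackson_primitive_tail (t : R) : 0 <= t <= pi ->
  (1 - cos t) ^+ 2 * (pi - jackson_primitive t) <= pi * jackson_moment.
Proof.
move=> /andP[t0 tp].
have := @is_derive_ge0_le R
  (fun x => moment_primitive x - (1 - cos t) ^+ 2 * jackson_primitive x)
  (fun x => ((1 - cos x) ^+ 2 - (1 - cos t) ^+ 2) * jackson_kernel d x) t pi.
have mt : 0 <= moment_primitive t.
  have <- : moment_primitive 0 = 0.
    rewrite /moment_primitive big1// => j _.
    have p0 (w : R) : cos_primitive w 0 = 0.
      by rewrite /cos_primitive mulr0 sin0 mul0r if_same.
    by rewrite /sqr_primitive !p0; ring.
  apply: (is_derive_ge0_le is_derive_moment_primitive) => // x _.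
  by rewrite mulr_ge0 ?sqr_ge0// jackson_kernel_ge0.
rewrite jackson_primitive_pi moment_primitive_pi => H.
have {}H := H _ _ tp; suff : 0 - (1 - cos t) ^+ 2 * jackson_primitive t
    <= pi * jackson_moment - (1 - cos t) ^+ 2 * pi by lra.
apply: le_trans (H _ _); first by rewrite lerB.
- move=> x; have h1 := is_derive_moment_primitive x.
  have h2 := is_derive_jackson_primitive x.
  apply: is_derive_eq; rewrite /GRing.scale/=; ring.
- move=> x /andP[tx xp]; rewrite mulr_ge0 ?jackson_kernel_ge0// subr_ge0.
  rewrite ler_pXn2r ?nnegrE ?subr_ge0 ?cos_le1// lerD2l lerN2 leNgt ltr_cos ?in_itv/=.
  + by rewrite -leNgt ltW.
  + by rewrite (le_trans t0 (ltW tx)) ltW.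
  + by rewrite t0.
Qed.
End JacksonPrimitive.

(** * The Chebyshev--Jackson polynomial *)

Lemma horner_chebyshevT_cos {R : realType} (j : nat) (x : R) :
  (chebyshevT R j).[cos x] = cos (j%:R * x).
Proof.
suff [] : (chebyshevT R j).[cos x] = cos (j%:R * x) /\
  (chebyshevT R j.+1).[cos x] = cos (j.+1%:R * x) by [].
elim: j => [|j [IH1 IH2]]; first by rewrite !hornerE ?(mul0r, cos0, mul1r).
split=> //; rewrite [chebyshevT _ _]/= -/(chebyshevT R j.+1) !hornerE IH2 IH1.
have -> : j.+2%:R * x = j.+1%:R * x + x by rewrite -[j.+2%:R]natr1; ring.
have -> : j%:R * x = j.+1%:R * x - x by rewrite -[j.+1%:R]natr1; ring.
by rewrite !cosD cosN sinN; ring.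
Qed.

(** The right side is the integral of the kernel over the translates by x of the two
    arcs [beta, alpha] and [-alpha, -beta]; termwise it is the product formula for
    cos (j x) sin (j alpha) and cos (j x) sin (j beta). *)
Lemma cheb_jackson_cosE {R : realType} (d : nat) (alpha beta x : R) :
  let F := @jackson_primitive R d in
  2 * pi * (cheb_jackson alpha beta d).[cos x]
  = F (x - beta) - F (x - alpha) + F (x + alpha) - F (x + beta).
Proof.
have p0 : pi != 0 :> R by rewrite gt_eqF ?pi_gt0.
rewrite /= /cheb_jackson hornerD hornerC horner_sum big_add1/= big_mkord.
rewrite mulrDr mulr_sumr /jackson_primitive -!sumrB -big_split/= -sumrB.
rewrite big_ord_recl big_ord_recr/= jackson_last !(mulr0, mul0r, subr0, addr0).
congr (_ + _).
  by rewrite /cos_weight jackson0 /step_coef/= !cos_primitive_0; move: (pi : R) p0 => q q0; field.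
apply: eq_bigr => j _; rewrite hornerZ -/(chebyshevT R j.+1) horner_chebyshevT_cos /bump/= add1n.
have n0 : j.+1%:R != 0 :> R by rewrite pnatr_eq0.
rewrite /step_coef/=; move: (pi : R) p0 => q q0.
rewrite /cos_weight /cos_primitive/= (negbTE n0) !mulrDr !mulrN.
rewrite !(sinD, sinN, cosN); move: (j.+1%:R : R) n0 => k k0.
by field; rewrite q0 k0.
Qed.

(** Bounds for the value gamma of a smoothed step, from a nondecreasing, odd and
    quasi-periodic primitive F of the smoothing kernel. Each proof compares the four
    arguments of F in [gammaE], reflecting them by oddness and quasi-periodicity when
    they lie beyond pi. *)
Section StepResponse.
Variables (R : realType) (F : R -> R) (alpha beta x gamma : R).
Hypothesis F_mono : forall y z : R, y <= z -> F y <= F z.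
Hypothesis FN : forall y : R, F (- y) = - F y.
Hypothesis FD2pi : forall y : R, F (y + pi *+ 2) = F y + pi *+ 2.
Hypothesis gammaE :
  2 * pi * gamma = F (x - beta) - F (x - alpha) + F (x + alpha) - F (x + beta).

Let F_odd (y z : R) : z = - y -> F z = - F y.
Proof. by move=> ->. Qed.

Let F_shift (y z : R) : z = y + 2 * pi -> F z = F y + 2 * pi.
Proof. by move=> ->; rewrite mulr_natl. Qed.

Let div_2pi (y : R) : 2 * pi * y <= 0 -> y <= 0.
Proof. by rewrite pmulr_rle0// mulr_gt0 ?pi_gt0. Qed.

Lemma step_response_ge0_le1 : 0 <= beta -> beta <= alpha -> alpha <= pi ->
  0 <= x -> x <= pi -> 0 <= gamma <= 1.
Proof.
move=> beta0 beta_alpha alpha_pi x0 x_pi; have gE := gammaE.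
have h1 : F (x - alpha) <= F (x - beta) by apply: F_mono; lra.
have h2 : F (x + beta) <= F (x + alpha) by apply: F_mono; lra.
have h3 : F (x + alpha) <= F (x - alpha + 2 * pi) by apply: F_mono; lra.
have h4 : F (x - beta) <= F (x + beta) by apply: F_mono; lra.
have h5 := @F_shift (x - alpha) _ erefl.
by apply/andP; split; [rewrite -oppr_le0|rewrite -subr_le0]; apply: div_2pi; lra.
Qed.

Variables (delta eps : R).
Hypothesis F_tail : pi * (1 - eps) <= F delta.

Lemma step_response_inside : 0 <= beta -> beta <= alpha -> alpha <= pi ->
  0 <= x -> x <= pi ->
  beta + delta <= x -> x <= alpha - delta -> 1 - eps <= gamma.
Proof.
move=> beta0 beta_alpha alpha_pi x0 x_pi; have gE := gammaE; have Ft := F_tail.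
move=> xl xr; have h1 : F delta <= F (x - beta) by apply: F_mono; lra.
have h2 : F delta <= F (alpha - x) by apply: F_mono; lra.
have h3 : F (x + beta) <= F (x + alpha) by apply: F_mono; lra.
have h4 : F (alpha - x) = - F (x - alpha) by apply: F_odd; ring.
by rewrite -subr_le0; apply: div_2pi; lra.
Qed.

Lemma step_response_left : 0 <= beta -> beta <= alpha -> alpha <= pi ->
  0 <= x -> x <= pi ->
  0 <= delta -> x <= beta - delta -> gamma <= eps.
Proof.
move=> beta0 beta_alpha alpha_pi x0 x_pi; have gE := gammaE; have Ft := F_tail.
move=> delta0 xb; have h1 : F (x + alpha) <= F (x - alpha + 2 * pi) by apply: F_mono; lra.
have h2 : F delta <= F (beta - x) by apply: F_mono; lra.
have h3 : F delta <= F (x + beta) by apply: F_mono; lra.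
have h4 : F (beta - x) = - F (x - beta) by apply: F_odd; ring.
have h5 := @F_shift (x - alpha) _ erefl.
by rewrite -subr_le0; apply: div_2pi; lra.
Qed.

Lemma step_response_right : 0 <= beta -> beta <= alpha -> alpha <= pi ->
  0 <= x -> x <= pi ->
  0 <= delta -> alpha + delta <= x -> gamma <= eps.
Proof.
move=> beta0 beta_alpha alpha_pi x0 x_pi; have gE := gammaE; have Ft := F_tail.
move=> delta0 xa; have h1 : F (x - beta) <= F (x + beta) by apply: F_mono; lra.
have h2 : F delta <= F (x - alpha) by apply: F_mono; lra.
have h3 : F delta <= F (2 * pi - x - alpha) by apply: F_mono; lra.
have h4 : F (x + alpha) = F (x + alpha - 2 * pi) + 2 * pi by apply: F_shift; ring.
have h5 : F (2 * pi - x - alpha) = - F (x + alpha - 2 * pi) by apply: F_odd; ring.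
by rewrite -subr_le0; apply: div_2pi; lra.
Qed.

Let F_0 : F 0 = 0.
Proof. by have := @F_odd 0 0; rewrite oppr0 => /(_ erefl); lra. Qed.

(** At an edge one of the four terms is F 0 = 0, and near it only half of the kernel is
    seen. The three assumptions on delta keep the other jumps, including the mirror
    images -beta and 2 pi - alpha, at distance at least delta. *)
Lemma step_response_edge : 0 <= beta -> beta <= alpha -> alpha <= pi ->
  0 <= x -> x <= pi ->
  0 <= delta -> beta + delta <= alpha ->
  delta <= beta -> alpha <= pi - delta -> x = alpha \/ x = beta ->
  1 / 2 - eps / 2 <= gamma <= 1 / 2 + eps / 2.
Proof.
move=> beta0 beta_alpha alpha_pi x0 x_pi; have gE := gammaE; have Ft := F_tail.
move=> delta0 ba db ap xab.
have h1 : F delta <= F (alpha - beta) by apply: F_mono; lra.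
suff : pi - pi * eps <= 2 * pi * gamma <= pi + pi * eps.
  move=> /andP[g1 g2]; apply/andP.
  by split; rewrite -subr_le0; apply: div_2pi; lra.
case: xab => xE; rewrite gammaE xE.
- have h2 : F (alpha - beta) <= F (alpha + beta) by apply: F_mono; lra.
  have h3 : F (alpha + beta) <= F (alpha + alpha) by apply: F_mono; lra.
  have h4 : F (alpha + alpha) = F (alpha + alpha - 2 * pi) + 2 * pi by apply: F_shift; ring.
  have h5 : F (2 * pi - alpha - alpha) = - F (alpha + alpha - 2 * pi) by apply: F_odd; ring.
  have h6 : F delta <= F (2 * pi - alpha - alpha) by apply: F_mono; lra.
  by rewrite subrr F_0; lra.
- have h2 : F (beta + beta) <= F (beta + alpha) by apply: F_mono; lra.
  have h3 : F (beta - alpha) = - F (alpha - beta) by apply: F_odd; ring.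
  have h4 : F (beta + alpha) = F (beta + alpha - 2 * pi) + 2 * pi by apply: F_shift; ring.
  have h5 : F (2 * pi - beta - alpha) = - F (beta + alpha - 2 * pi) by apply: F_odd; ring.
  have h6 : F (alpha - beta) <= F (2 * pi - beta - alpha) by apply: F_mono; lra.
  have h7 : F delta <= F (beta + beta) by apply: F_mono; lra.
  by rewrite subrr F_0; lra.
Qed.

End StepResponse.

(** An upper bound for the proportion of the mass of the kernel outside [-t, t]. *)
Definition jackson_tail {R : realType} (d : nat) (t : R) : R :=
  jackson_moment R d / (1 - cos t) ^+ 2.


Lemma one_sub_cos_gt0 {R : realType} (t : R) : 0 < t -> t <= pi -> 0 < 1 - cos t.
Proof.
move=> t0 tpi; have := @one_sub_cos_ge R t; rewrite tpi ltW// => /(_ isT) h.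
rewrite -(@pmulr_rgt0 _ (pi ^+ 2)) ?exprn_gt0 ?pi_gt0//.
by apply: lt_le_trans h; rewrite mulr_gt0 ?exprn_gt0.
Qed.

Lemma jackson_primitive_ge {R : realType} (d : nat) (t : R) : (0 < d)%N -> 0 < t -> t <= pi ->
  pi * (1 - jackson_tail d t) <= jackson_primitive d t.
Proof.
move=> d0 t0 tpi; have cos_lt := one_sub_cos_gt0 t0 tpi.
have := @jackson_primitive_tail R d d0 t; rewrite tpi ltW// => /(_ isT) h.
rewrite mulrBr mulr1 lerBlDl -lerBlDr /jackson_tail mulrA ler_pdivlMr ?exprn_gt0//.
by rewrite mulrC.
Qed.

Lemma jackson_tail_ge0 {R : realType} (d : nat) (t : R) : 0 <= jackson_tail d t.
Proof.
have D0 : 0 <= d%:R + 2 :> R by rewrite addr_ge0.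
by rewrite divr_ge0 ?sqr_ge0// addr_ge0 ?divr_ge0 ?sqr_ge0.
Qed.

(** With y = pi / (d + 2), the two terms are at most y^4 / 4 and y^2 / (d + 2). Their
    quotient pi^2 / (4 (d + 2)) is below 1 because d + 2 >= 3 and pi^2 < 12. *)
Lemma jackson_moment_lt {R : realType} (d : nat) : (0 < d)%N ->
  jackson_moment R d < 2 * pi ^+ 2 / (d%:R + 2) ^+ 3.
Proof.
move=> d0; have D3 : 3 <= d%:R + 2 :> R.
  by have : 1 <= d%:R :> R; [rewrite ler1n|lra].
rewrite /jackson_moment; set D := d%:R + 2 in D3 *.
have D0 : 0 < D by lra.
set y := pi / D; have y0 : 0 < y by rewrite divr_gt0 ?pi_gt0.
have h1 := one_sub_cos_le (ltW y0).
have h2 : (1 - cos y) ^+ 2 <= (y ^+ 2 / 2) ^+ 2.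
  by rewrite ler_pXn2r ?nnegrE ?subr_ge0 ?cos_le1 ?divr_ge0 ?sqr_ge0.
have h3 : sin y ^+ 2 / D <= y ^+ 2 / D.
  rewrite ler_pM2r ?invr_gt0// ler_pXn2r ?nnegrE ?sin_le_id// ltW//.
  rewrite sin_gt0_pi// y0/= /y ltr_pdivrMr// ltr_pMr ?pi_gt0//; lra.
apply: (le_lt_trans (lerD h2 h3)).
have -> : (y ^+ 2 / 2) ^+ 2 + y ^+ 2 / D = pi ^+ 2 / D ^+ 3 * (pi ^+ 2 / (4 * D) + 1).
  by rewrite /y; field; rewrite gt_eqF.
have -> : 2 * pi ^+ 2 / D ^+ 3 = pi ^+ 2 / D ^+ 3 * 2 by ring.
rewrite ltr_pM2l ?divr_gt0 ?exprn_gt0 ?pi_gt0//.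
suff : pi ^+ 2 / (4 * D) < 1 by lra.
by rewrite ltr_pdivrMr; have := @sqr_pi_lt12 R; lra.
Qed.

Lemma jackson_tail_lt {R : realType} (d : nat) (t : R) :
  (0 < d)%N -> 0 < t -> t <= pi ->
  jackson_tail d t < pi ^+ 6 / (2 * (d%:R + 2) ^+ 3 * t ^+ 4).
Proof.
move=> d0 t0 tpi; have cos_lt := one_sub_cos_gt0 t0 tpi.
have D0 : 0 < d%:R + 2 :> R by have := ler0n R d; lra.
rewrite /jackson_tail ltr_pdivrMr ?exprn_gt0//; apply: lt_le_trans (jackson_moment_lt d0) _.
have := @one_sub_cos_ge R t; rewrite tpi ltW// => /(_ isT) h.
have : (2 * t ^+ 2) ^+ 2 <= (pi ^+ 2 * (1 - cos t)) ^+ 2.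
  by rewrite ler_pXn2r ?nnegrE// ltW// mulr_gt0 ?exprn_gt0 ?pi_gt0.
move=> {}h; set c := 1 - cos t in h *; set D := d%:R + 2 in D0 *.
have -> : pi ^+ 6 / (2 * D ^+ 3 * t ^+ 4) * c ^+ 2
    = pi ^+ 2 / (2 * D ^+ 3 * t ^+ 4) * (pi ^+ 2 * c) ^+ 2.
  by field; rewrite !gt_eqF.
have -> : 2 * pi ^+ 2 / D ^+ 3 = pi ^+ 2 / (2 * D ^+ 3 * t ^+ 4) * (2 * t ^+ 2) ^+ 2.
  by field; rewrite !gt_eqF.
by rewrite ler_pM2l// divr_gt0 ?mulr_gt0 ?exprn_gt0 ?pi_gt0.
Qed.

Lemma cheb_jackson_error {R : realType} (d : nat) (alpha beta delta x : R) :
  (0 < d)%N -> 0 < delta -> beta + delta <= alpha -> delta <= beta ->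
  alpha <= pi - delta -> 0 <= x -> x <= pi ->
  let gamma := (cheb_jackson alpha beta d).[cos x] in
  let eps := jackson_tail d delta in
  [/\ 0 <= gamma <= 1,
      beta + delta <= x -> x <= alpha - delta -> 1 - eps <= gamma,
      x <= beta - delta \/ alpha + delta <= x -> gamma <= eps &
      x = alpha \/ x = beta -> 1 / 2 - eps / 2 <= gamma <= 1 / 2 + eps / 2].
Proof.
move=> d0 delta0 ba db ap x0 xp gamma eps.
have delta_pi : delta <= pi by lra.
have [beta0 beta_alpha alpha_pi] : [/\ 0 <= beta, beta <= alpha & alpha <= pi].
  by split; lra.
have tail := jackson_primitive_ge d0 delta0 delta_pi.
have mono := @jackson_primitive_mono R d.
have odd := @jackson_primitiveN R d.
have quasi := @jackson_primitiveD2pi R d.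
have gE := @cheb_jackson_cosE R d alpha beta x.
have delta0' := ltW delta0.
split.
- exact: (step_response_ge0_le1 mono quasi gE).
- exact: (step_response_inside mono odd gE tail).
- by case=> h; [exact: (step_response_left mono odd quasi gE tail)
               |exact: (step_response_right mono odd quasi gE tail)].
- exact: (step_response_edge mono odd quasi gE tail).
Qed.

(** * The spectral norm and functions of a singular value decomposition *)

Lemma norm2_ge0 {R : realType} (n : nat) (x : 'cV[R]_n) : 0 <= norm2 x.
Proof. exact: sqrtr_ge0. Qed.

Lemma norm2_0 {R : realType} (n : nat) : norm2 (0 : 'cV[R]_n) = 0.
Proof. by rewrite /norm2 big1 ?sqrtr0// => i _; rewrite mxE expr0n. Qed.

Lemma norm2_isometry {R : realType} (m n : nat) (U : 'M[R]_(m, n)) (x : 'cV[R]_n) :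
  U^T *m U = 1%:M -> norm2 (U *m x) = norm2 x.
Proof.
have sqrE p (y : 'cV[R]_p) : norm2 y = Num.sqrt ((y^T *m y) 0 0).
  by rewrite /norm2 mxE; congr Num.sqrt; apply: eq_bigr => i _; rewrite mxE expr2.
by move=> UU; rewrite !sqrE trmx_mul -mulmxA (mulmxA U^T) UU mul1mx.
Qed.

Lemma norm2_diag_le {R : realType} (n : nat) (g : 'rV[R]_n) (c : R) (x : 'cV[R]_n) :
  0 <= c -> (forall i, `|g 0 i| <= c) -> norm2 (diag_mx g *m x) <= c * norm2 x.
Proof.
move=> c0 gc; rewrite -{1}(ger0_norm c0) -sqrtr_sqr -sqrtrM ?sqr_ge0//.
apply: ler_wsqrtr; rewrite mulr_sumr; apply: ler_sum => i _.
rewrite mul_diag_mx mxE exprMn ler_wpM2r ?sqr_ge0//.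
by rewrite -[leLHS]real_normK ?num_real// ler_pXn2r ?nnegrE.
Qed.

Lemma spectral_norm_le {R : realType} (m n : nat) (M : 'M[R]_(m, n)) (c : R) :
  0 <= c -> (forall x, norm2 (M *m x) <= c * norm2 x) -> spectral_norm M <= c.
Proof.
move=> c0 Mc; apply: ge_sup.
  by exists (norm2 (M *m 0)); exists 0 => //=; rewrite norm2_0.
move=> _ [x /= x1 <-]; apply: le_trans (Mc x) _.
by rewrite -[leRHS]mulr1 ler_wpM2l.
Qed.

(** The constant c shows that the supremum is over a bounded set; in an unbounded case
    it would be a meaningless default value. *)
Lemma norm2_le_spectral_norm {R : realType} (m n : nat) (M : 'M[R]_(m, n)) (c : R)
    (x : 'cV[R]_n) :
  0 <= c -> (forall x, norm2 (M *m x) <= c * norm2 x) -> norm2 x <= 1 ->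
  norm2 (M *m x) <= spectral_norm M.
Proof.
move=> c0 Mc x1; apply: ub_le_sup; last by exists x.
exists c => _ [y /= y1 <-]; apply: le_trans (Mc y) _.
by rewrite -[leRHS]mulr1 ler_wpM2l.
Qed.

Definition step_value {R : realType} (a b x : R) : R :=
  if a < x < b then 1 else if (x == a) || (x == b) then 1 / 2 else 0.

Lemma step_value_error {R : realType} (a b x g eps : R) : 0 <= eps -> 0 <= g <= 1 ->
  (a < x < b -> 1 - eps <= g) -> (x < a \/ b < x -> g <= eps) ->
  (x = a \/ x = b -> 1 / 2 - eps / 2 <= g <= 1 / 2 + eps / 2) ->
  `|step_value a b x - g| <= eps.
Proof.
move=> eps0 g01 gin gout gedge; rewrite /step_value.
case: ifP => [/gin h|nin]; first by rewrite ger0_norm; lra.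
case: ifP => [e|ne].
  have /gedge h : x = a \/ x = b by case/orP: e => /eqP; [left|right].
  by rewrite ler_norml; lra.
have /gout h : x < a \/ b < x.
  move: nin ne; case: (ltgtP x a) => //= [|_]; first by left.
  by case: (ltgtP x b) => //= h'; right.
by rewrite sub0r normrN ger0_norm; lra.
Qed.

Section Svd.
Variables (R : realType) (m n : nat) (A U : 'M[R]_(m, n.+1)) (s : 'rV[R]_n.+1)
  (V : 'M[R]_n.+1).

(** The norm of A is tested on the right singular vector of index i. *)
Lemma singular_value_le_spectral_norm (i : 'I_n.+1) :
  is_svd A U s V -> s 0 i <= spectral_norm A.
Proof.
move=> [UU VV s0 AE]; have VV' : V *m V^T = 1%:M by exact: mulmx1C.
pose e : 'cV[R]_n.+1 := delta_mx i 0.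
have ne : norm2 e = 1.
  rewrite /norm2 (bigD1 i)//= big1 ?addr0 => [|j ji].
    by rewrite mxE !eqxx expr1n sqrtr1.
  by rewrite mxE (negbTE ji) expr0n.
have c0 : 0 <= \sum_j s 0 j by apply: sumr_ge0.
have Ac x : norm2 (A *m x) <= (\sum_j s 0 j) * norm2 x.
  rewrite AE -!mulmxA norm2_isometry//.
  rewrite -(@norm2_isometry _ _ _ V^T x) ?trmxK//.
  apply: norm2_diag_le => // j; rewrite ger0_norm// (bigD1 j)//= lerDl.
  exact: sumr_ge0.
have -> : s 0 i = norm2 (A *m (V *m e)).
  rewrite AE -!mulmxA (mulmxA V^T) VV mul1mx norm2_isometry//.
  rewrite mul_diag_mx /norm2 (bigD1 i)//= big1 ?addr0 => [|j ji].
    by rewrite !mxE !eqxx mulr1 sqrtr_sqr ger0_norm.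
  by rewrite !mxE (negbTE ji) mulr0 expr0n.
by apply: norm2_le_spectral_norm c0 Ac _; rewrite norm2_isometry// ne.
Qed.

Lemma subcols_mul_trmx (J : {set 'I_n.+1}) :
  subcols V J *m (subcols V J)^T = V *m diag_mx (\row_i (i \in J)%:R) *m V^T.
Proof.
apply/matrixP => i k; rewrite mul_mx_diag !mxE.
under eq_bigr => j _ do rewrite !mxE.
under [RHS]eq_bigr => j _ do rewrite !mxE.
rewrite -(big_enum_val (fun j => V i j * V k j)) /= [RHS](bigID (mem J))/=.
rewrite [X in _ = _ + X]big1 ?addr0 => [|j /negbTE ->]; last by rewrite mulr0 mul0r.
by apply: eq_bigr => j ->; rewrite mulr1.
Qed.

Lemma spectral_projectorE (a b : R) : 0 <= a -> a < b -> (forall i, 0 <= s 0 i) ->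
  spectral_projector s V a b = V *m diag_mx (\row_i step_value a b (s 0 i)) *m V^T.
Proof.
move=> a0 ab s0; have b0 : 0 <= b by apply: le_trans a0 (ltW ab).
rewrite /spectral_projector !subcols_mul_trmx scalemxAl scalemxAr -mulmxDl -mulmxDr.
rewrite -linearZ -linearD; congr (_ *m diag_mx _ *m _).
apply/rowP => i; rewrite !mxE !inE !ltr_pXn2r ?nnegrE// !eqrXn2//.
rewrite /step_value; case: (boolP (a < s 0 i < b)) => [/andP[h1 h2]|_].
  by rewrite (gt_eqF h1) (lt_eqF h2) mulr0 addr0.
by case: (_ || _); rewrite ?mulr0 ?mulr1 add0r ?mul1r.
Qed.

Lemma horner_mx_gram (p q : {poly R}) : is_svd A U s V ->
  horner_mx (horner_mx (A^T *m A) p) q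
  = V *m diag_mx (\row_i q.[p.[s 0 i ^+ 2]]) *m V^T.
Proof.
move=> [UU VV s0 AE].
have [_ Vu] := mulmx1_unit VV.
have VT : V^T = invmx V by rewrite -[LHS]mulmx1 -(mulmxV Vu) mulmxA VV mul1mx.
have -> : A^T *m A = V *m diag_mx (\row_i s 0 i ^+ 2) *m invmx V.
  rewrite -VT AE !trmx_mul trmxK tr_diag_mx !mulmxA -(mulmxA _ U^T) UU mulmx1.
  by rewrite -(mulmxA V (diag_mx s)) mulmx_diag; congr (_ *m diag_mx _ *m _);
    apply/rowP => i; rewrite !mxE expr2.
rewrite !horner_mx_uconj// !horner_mx_diag VT; congr (_ *m diag_mx _ *m _).
by apply/rowP => i; rewrite !mxE.
Qed.

Lemma spectral_norm_conj_diag_le (g : 'rV[R]_n.+1) (c : R) :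
  V^T *m V = 1%:M -> 0 <= c -> (forall i, `|g 0 i| <= c) ->
  spectral_norm (V *m diag_mx g *m V^T) <= c.
Proof.
move=> VV c0 gc; have VV' : V *m V^T = 1%:M by exact: mulmx1C.
apply: spectral_norm_le => // x; rewrite -!mulmxA norm2_isometry//.
by rewrite -[X in _ <= _ * X](@norm2_isometry _ _ _ V^T) ?trmxK// norm2_diag_le.
Qed.

End Svd.

(** * The angles of the singular values *)

(** In this angular variable the Chebyshev polynomials are cosines, and the distances to
    the jumps are measured in it. *)
Definition angle {R : realType} (N smin x : R) : R := acos (lmap N smin).[x ^+ 2].

Lemma horner_lmap {R : realType} (N smin y : R) :
  (lmap N smin).[y] = (2 * y - (N ^+ 2 + smin ^+ 2)) / (N ^+ 2 - smin ^+ 2).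
Proof. by rewrite /lmap !hornerE mulrC. Qed.

Section Angle.
Variables (R : realType) (N smin : R).

Lemma lmap_itv (x : R) : 0 <= smin -> smin < N -> smin <= x -> x <= N ->
  -1 <= (lmap N smin).[x ^+ 2] <= 1.
Proof.
move=> s0 sN sx xN.
have h0 : 0 < N ^+ 2 - smin ^+ 2 by rewrite subr_gt0 ltr_pXn2r ?nnegrE//; lra.
have h1 : smin ^+ 2 <= x ^+ 2 by rewrite ler_pXn2r ?nnegrE//; lra.
have h2 : x ^+ 2 <= N ^+ 2 by rewrite ler_pXn2r ?nnegrE//; lra.
by rewrite horner_lmap ler_pdivlMr// ler_pdivrMr//; apply/andP; split; lra.
Qed.

Lemma cos_angle (x : R) : 0 <= smin -> smin < N -> smin <= x -> x <= N ->
  cos (angle N smin x) = (lmap N smin).[x ^+ 2].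
Proof. by move=> s0 sN sx xN; rewrite acosK// in_itv/= lmap_itv. Qed.

Lemma angle_itv (x : R) : 0 <= smin -> smin < N -> smin <= x -> x <= N ->
  0 <= angle N smin x <= pi.
Proof. by move=> s0 sN sx xN; rewrite acos_ge0 ?acos_lepi// lmap_itv. Qed.

Lemma angle_lt (x y : R) : 0 <= smin -> smin <= x -> x < y -> y <= N ->
  angle N smin y < angle N smin x.
Proof.
move=> s0 sx xy yN; have sN : smin < N by lra.
have [sy xN] : smin <= y /\ x <= N by lra.
rewrite -ltr_cos ?in_itv/= ?angle_itv// !cos_angle// !horner_lmap.
have h0 : 0 < N ^+ 2 - smin ^+ 2 by rewrite subr_gt0 ltr_pXn2r ?nnegrE//; lra.
have h1 : x ^+ 2 < y ^+ 2 by rewrite ltr_pXn2r ?nnegrE//; lra.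
by rewrite ltr_pM2r ?invr_gt0//; lra.
Qed.

Lemma angle_le (x y : R) : 0 <= smin -> smin <= x -> x <= y -> y <= N ->
  angle N smin y <= angle N smin x.
Proof.
move=> s0 sx; rewrite le_eqVlt => /predU1P[->//|xy] yN.
exact/ltW/angle_lt.
Qed.
End Angle.

(** The condition on d is the cube root of 2 pi^6 / t^4 <= (d + 2)^3. *)
Lemma tail_bound_le_quarter {R : realType} (d : nat) (t : R) : 0 < t ->
  2 `^ (1 / 3) * pi ^+ 2 / t `^ (4 / 3) - 2 <= d%:R ->
  pi ^+ 6 / (2 * (d%:R + 2) ^+ 3 * t ^+ 4) <= 1 / 4.
Proof.
move=> t0; set X := (X in X - 2 <= _) => Xd.
have D0 : 0 < d%:R + 2 :> R by have := ler0n R d; lra.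
have X0 : 0 <= X by rewrite divr_ge0 ?powR_ge0// mulr_ge0 ?powR_ge0 ?sqr_ge0.
have : X ^+ 3 <= (d%:R + 2) ^+ 3.
  by rewrite ler_pXn2r ?nnegrE ?(ltW D0)//; lra.
have -> : X ^+ 3 = 2 * pi ^+ 6 / t ^+ 4.
  have p3 (y z : R) : 0 <= y -> (y `^ (z / 3)) ^+ 3 = y `^ z.
    by move=> y0; rewrite -powR_mulrn ?powR_ge0// -powRrM divfK.
  by rewrite /X expr_div_n exprMn !p3// ?(ltW t0)// powRr1// -exprM powR_mulrn ?(ltW t0).
rewrite ler_pdivrMr ?exprn_gt0// => h.
rewrite ler_pdivrMr; last by rewrite !mulr_gt0 ?exprn_gt0.
by lra.
Qed.

(** Inside a group the order is assumed; between groups the values are separated by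
    the thresholds u and v. *)
Lemma grouped_nonincreasing {R : realType} (n r nsv : nat) (gamma : 'I_n -> R)
    (u v : R) :
  (forall i : 'I_n, (i < r)%N -> v < gamma i) ->
  (forall i : 'I_n, (r <= i < nsv)%N -> u < gamma i < v) ->
  (forall i : 'I_n, (nsv <= i)%N -> gamma i < u) -> u < v ->
  (forall i j : 'I_n, (i <= j)%N ->
     (j < r)%N \/ (r <= i)%N /\ (j < nsv)%N \/ (nsv <= i)%N ->
     gamma j <= gamma i) ->
  forall i j : 'I_n, (i <= j)%N -> gamma j <= gamma i.
Proof.
move=> gamma_in gamma_edge gamma_out uv decr i j ij.
have [jr|rj] := ltnP j r; first by apply: decr => //; left.
have [ni|in_] := leqP nsv i; first by apply: decr => //; right; right.
have [jn|nj] := ltnP j nsv; last first.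
  have := gamma_out _ nj; have [ir|ri] := ltnP i r; first by have := gamma_in _ ir; lra.
  by have := gamma_edge i; rewrite ri in_ => /(_ isT); lra.
have [ri|ir] := leqP r i; first by apply: decr => //; right; left.
by have := gamma_in _ ir; have := gamma_edge j; rewrite rj jn => /(_ isT); lra.
Qed.

Theorem theorem4p1 (R : realType) (m n : nat) (hmn : (n.+1 <= m)%N)
    (A U : 'M[R]_(m, n.+1)) (s : 'rV[R]_n.+1) (V : 'M[R]_n.+1)
    (hsvd : is_svd A U s V)
    (smin : R) (hsmin : is_smallest (range (s 0)) smin)
    (a b : R) (ha : smin <= a) (hab : a < b) (hb : b <= spectral_norm A)
    (d : nat) (hd : (0 < d)%N)
    (sil sir sol sor : R)
    (hil : is_smallest [set x | range (s 0) x /\ a < x < b] sil)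
    (hir : is_largest [set x | range (s 0) x /\ a < x < b] sir)
    (hol : is_largest [set x | range (s 0) x /\ x < a] sol)
    (hor : is_smallest [set x | range (s 0) x /\ b < x] sor) :
  let l : {poly R} := lmap (spectral_norm A) smin in
  let theta (x : R) : R := acos l.[x ^+ 2] in
  let alpha := theta a in
  let beta := theta b in
  let psi : {poly R} := cheb_jackson alpha beta d in
  let S : 'M[R]_n.+1 := A^T *m A in
  let PS : 'M[R]_n.+1 := spectral_projector s V a b in
  let P : 'M[R]_n.+1 := horner_mx (horner_mx S l) psi in
  let Dil := `|theta sil - alpha| in
  let Dir := `|theta sir - beta| in
  let Dol := `|theta sol - alpha| in
  let Dor := `|theta sor - beta| in
  let Dmin := Num.min (Num.min Dil Dir) (Num.min Dol Dor) in
  spectral_norm (PS - P) <= pi ^+ 6 / (2 * (d%:R + 2) ^+ 3 * Dmin ^+ 4)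
  /\
  (2 `^ (1 / 3) * pi ^+ 2 / Dmin `^ (4 / 3) - 2 <= d%:R ->
   spectral_norm (PS - P) < 1 / 4
   /\
   (* p relabels the singular values so that their indices 0, ..., n are listed
      group by group, with the values gamma decreasing within each group. *)
   forall (p : 'S_n.+1) (r nsv : nat),
     let sigma (i : 'I_n.+1) : R := s 0 (p i) in
     let gamma (i : 'I_n.+1) : R := psi.[l.[sigma i ^+ 2]] in
     (r <= nsv)%N -> (nsv <= n.+1)%N ->
     (forall i : 'I_n.+1, (i < r)%N -> a < sigma i < b) ->
     (forall i : 'I_n.+1, (r <= i < nsv)%N -> sigma i = a \/ sigma i = b) ->
     (forall i : 'I_n.+1, (nsv <= i)%N -> sigma i < a \/ b < sigma i) ->
     (forall i j : 'I_n.+1, (i <= j)%N ->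
        (j < r)%N \/ (r <= i)%N /\ (j < nsv)%N \/ (nsv <= i)%N ->
        gamma j <= gamma i) ->
     (forall i j : 'I_n.+1, (i <= j)%N -> gamma j <= gamma i)
     /\ (forall i : 'I_n.+1, (i < r)%N -> 3 / 4 < gamma i <= 1)
     /\ (forall i : 'I_n.+1, (r <= i < nsv)%N -> 1 / 4 < gamma i < 3 / 4)
     /\ (forall i : 'I_n.+1, (nsv <= i)%N -> 0 <= gamma i < 1 / 4)).
Proof.
move=> l theta alpha beta psi S PS P Dil Dir Dol Dor Dmin.
have [_ VV s0 _] := hsvd.
set N := spectral_norm A in hb l theta alpha beta psi P Dil Dir Dol Dor Dmin *.
have [[i0 _ smin_i0] smin_lb] := hsmin.
have smin0 : 0 <= smin by rewrite -smin_i0.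
have smin_le i : smin <= s 0 i by apply: smin_lb; exists i.
have le_N i : s 0 i <= N by exact: singular_value_le_spectral_norm hsvd.
have sN : smin < N by lra.
have [aN sb] : a <= N /\ smin <= b by lra.
have range_le x : range (s 0) x -> smin <= x <= N.
  by case=> i _ <-; rewrite smin_le le_N.
have lt_theta x y : smin <= x -> x < y -> y <= N -> theta y < theta x.
  exact: angle_lt.
have le_theta x y : smin <= x -> x <= y -> y <= N -> theta y <= theta x.
  exact: angle_le.
have itv_theta x : smin <= x -> x <= N -> 0 <= theta x <= pi.
  exact: angle_itv.
have [[[ril /andP[ail ilb]] il_lb] [[rir /andP[air irb]] ir_ub]] := (hil, hir).
have [[[rol ola] ol_ub] [[ror bor] or_lb]] := (hol, hor).
have /andP[sil_min sil_N] := range_le _ ril.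
have /andP[sir_min sir_N] := range_le _ rir.
have /andP[sol_min sol_N] := range_le _ rol.
have /andP[sor_min sor_N] := range_le _ ror.
(* The angle decreases, so the signs of the four differences are determined. *)
have Dil0 : 0 < Dil /\ theta sil = alpha - Dil.
  have := lt_theta a sil ha ail sil_N; rewrite -/alpha => h.
  by rewrite /Dil ltr0_norm; lra.
have Dir0 : 0 < Dir /\ theta sir = beta + Dir.
  have := lt_theta sir b sir_min irb hb; rewrite -/beta => h.
  by rewrite /Dir gtr0_norm; lra.
have Dol0 : 0 < Dol /\ theta sol = alpha + Dol.
  have := lt_theta sol a sol_min ola aN; rewrite -/alpha => h.
  by rewrite /Dol gtr0_norm; lra.
have Dor0 : 0 < Dor /\ theta sor = beta - Dor.
  have := lt_theta b sor sb bor sor_N; rewrite -/beta => h.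
  by rewrite /Dor ltr0_norm; lra.
have [Dmin_il Dmin_ir Dmin_ol Dmin_or] :
    [/\ Dmin <= Dil, Dmin <= Dir, Dmin <= Dol & Dmin <= Dor].
  by rewrite /Dmin; split; rewrite !ge_min lexx ?orbT.
have Dmin0 : 0 < Dmin by rewrite /Dmin !lt_min; apply/andP; split; apply/andP; lra.
(* alpha - beta, beta and pi - alpha each contain a gap around a neighbouring angle. *)
have ba : beta + Dmin <= alpha.
  by have := lt_theta sil b sil_min ilb hb; rewrite -/beta; lra.
have Db : Dmin <= beta by have := itv_theta sor sor_min sor_N; lra.
have ap : alpha <= pi - Dmin by have := itv_theta sol sol_min sol_N; lra.
have Dmin_pi : Dmin <= pi by lra.
pose eps := jackson_tail d Dmin.
have eps0 : 0 <= eps by exact: jackson_tail_ge0.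
pose g i := psi.[l.[s 0 i ^+ 2]].
have g_err i : [/\ 0 <= g i <= 1, a < s 0 i < b -> 1 - eps <= g i,
    s 0 i < a \/ b < s 0 i -> g i <= eps &
    s 0 i = a \/ s 0 i = b -> 1 / 2 - eps / 2 <= g i <= 1 / 2 + eps / 2].
  have /andP[th0 thpi] := itv_theta _ (smin_le i) (le_N i).
  have := cheb_jackson_error hd Dmin0 ba Db ap th0 thpi.
  rewrite /theta cos_angle// -/(theta (s 0 i)) -/psi -/l -/(g i) -/eps.
  case=> g01 gin gout gedge; split=> //.
  - move=> /andP[ai ib]; apply: gin.
    + have : theta sir <= theta (s 0 i).
        apply: le_theta => //; apply: ir_ub; split; [by exists i|by rewrite ai].
      by lra.
    + have : theta (s 0 i) <= theta sil.
        apply: le_theta => //; apply: il_lb; split; [by exists i|by rewrite ai].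
      by lra.
  - case=> h; apply: gout.
    + right; have : theta sol <= theta (s 0 i).
        by apply: le_theta => //; apply: ol_ub; split; [exists i|].
      by lra.
    + left; have : theta (s 0 i) <= theta sor.
        by apply: le_theta => //; apply: or_lb; split; [exists i|].
      by lra.
  - by case=> h; apply: gedge; rewrite h; [left|right].
have norm_le : spectral_norm (PS - P) <= eps.
  rewrite /PS /P spectral_projectorE ?(horner_mx_gram _ _ hsvd)//; last lra.
  rewrite -mulmxBl -mulmxBr -linearB; apply: spectral_norm_conj_diag_le => // i.
  rewrite !mxE -/(g i); have [g01 gin gout gedge] := g_err i.
  exact: step_value_error.
have eps_lt : eps < pi ^+ 6 / (2 * (d%:R + 2) ^+ 3 * Dmin ^+ 4).
  exact: jackson_tail_lt.
split; first by rewrite (le_trans norm_le)// ltW.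
move=> /(tail_bound_le_quarter Dmin0) quarter.
have eps_quarter : eps < 1 / 4 by exact: lt_le_trans quarter.
split; first exact: le_lt_trans eps_quarter.
move=> p r nsv sigma gamma r_nsv nsv_n sigma_in sigma_edge sigma_out gamma_decr.
have gE i : gamma i = g (p i) by [].
clearbody gamma.
have gamma_in (i : 'I_n.+1) : (i < r)%N -> 3 / 4 < gamma i <= 1.
  by move=> /sigma_in h; have [g01 /(_ h) h' _ _] := g_err (p i); rewrite gE; lra.
have gamma_edge (i : 'I_n.+1) : (r <= i < nsv)%N -> 1 / 4 < gamma i < 3 / 4.
  by move=> /sigma_edge h; have [_ _ _ /(_ h) h'] := g_err (p i); rewrite gE; lra.
have gamma_out (i : 'I_n.+1) : (nsv <= i)%N -> 0 <= gamma i < 1 / 4.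
  by move=> /sigma_out h; have [g01 _ /(_ h) h' _] := g_err (p i); rewrite gE; lra.
split=> //; apply: (@grouped_nonincreasing _ _ r nsv gamma (1 / 4) (3 / 4)) => //.
- by move=> i /gamma_in/andP[].
- by move=> i /gamma_out/andP[].
- lra.
Qed.
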